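(* Let $(\mathcal{X},d)$ be a Polish metric space, let $\kappa\in(0,1)$, and let $P$ be a Markov kernel on $\mathcal{X}$ such that $P^n(x,\cdot)\in\mathcal{P}_1(\mathcal{X})$ and $W_1(P^n(x,\cdot),P^n(y,\cdot))\le\kappa^n d(x,y)$ for all $n\in\mathbb{N}$ and $x,y\in\mathcal{X}$. Let $(X_n)_{n\ge0}$ be a time-homogeneous Markov chain on $\mathcal{X}$ with kernel $P$, let $\mu\in\mathcal{P}_1(\mathcal{X})$ be its unique invariant probability measure, and let $\mu_n=\frac1n\sum_{i=1}^n\delta_{X_i}$ for $n\in\mathbb{N}$. Let $C>0$ and suppose that the initial distribution (the law of $X_0$) and the kernels $P(x,\cdot)$ for all $x\in\mathcal{X}$ satisfy the transportation inequality $T_1(C)$. Let $S\subseteq\operatorname{Lip}_1(\mathcal{X})$ be an arbitrary class of functions. Then for all $t\ge0$ and $n\in\mathbb{N}$, $$\mathbb{P}\big(d_S(\mu,\mu_n)\ge\mathbb{E}[d_S(\mu,\mu_n)]+t\big)\le\exp\Big(-\frac{1}{2C}\,n\,t^2(1-\kappa)^2\Big).$$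
   Context: $\mathbb{N}=\{1,2,\dots\}$. $\mathcal{P}(\mathcal{X})$ is the set of Borel probability measures on $\mathcal{X}$ and $\mathcal{P}_1(\mathcal{X})$ the subset of those with finite first moment; $W_1$ is the $1$-Wasserstein distance with respect to $d$; $P^n$ is the $n$-fold iterate of $P$. $\operatorname{Lip}_1(\mathcal{X})$ is the set of $1$-Lipschitz functions $\mathcal{X}\to\mathbb{R}$. The contraction hypothesis implies that $P$ has a unique invariant probability measure $\mu\in\mathcal{P}_1(\mathcal{X})$. For $\mu,\nu\in\mathcal{P}_1(\mathcal{X})$, $d_S(\mu,\nu)=\sup_{f\in S}|\mu(f)-\nu(f)|$, where $\mu(f)=\int f\,d\mu$. A measure $\rho\in\mathcal{P}_1(\mathcal{X})$ satisfies $T_1(C)$ if $W_1(\rho,\nu)\le\sqrt{2C\,H(\nu\mid\rho)}$ for all $\nu\in\mathcal{P}(\mathcal{X})$ with $\nu\ll\rho$, where $H(\nu\mid\rho)=\int\log\frac{d\nu}{d\rho}\,d\nu$ is the relative entropy. *)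

(* Defs.v *)
From HB Require Import structures.
From mathcomp Require Import all_boot all_order all_algebra.
From mathcomp Require Import all_classical all_reals all_analysis.

Set Implicit Arguments.
Unset Strict Implicit.
Unset Printing Implicit Defensive.

Import Order.TTheory GRing.Theory Num.Theory.
Import numFieldNormedType.Exports.

Local Open Scope classical_set_scope.
Local Open Scope ring_scope.
Local Open Scope ereal_scope.
Local Open Scope charge_scope.

HB.mixin Record isSeparable T & Topological T := {
  separable : exists2 D : set T, countable D & dense D
}.

(* [Complete] also provides a point; this excludes only the empty space, which
   carries no probability measure. *)
#[short(type="polishMetricType")]
HB.structure Definition PolishMetric (R : numDomainType) :=
  { M of Metric R M & Complete M & isSeparable M }.

Notation borel X := (g_sigma_algebraType (@open X)).

(* A probability kernel is a map into measures; this packs its values as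
   probability measures. *)
Section kernel_at.
Context d d' (T : measurableType d) (U : measurableType d') (R : realType).
Variables (k : R.-pker T ~> U) (x : T).

Definition kernel_at : set U -> \bar R := k x.

HB.instance Definition _ := Measure.on kernel_at.

Let kernel_at_setT : kernel_at setT = 1.
Proof. exact: prob_kernel. Qed.

HB.instance Definition _ :=
  Measure_isProbability.Build _ _ _ kernel_at kernel_at_setT.

End kernel_at.

Section kernel_iterates.
Context d (T : measurableType d) (R : realType) (P : R.-pker T ~> T).

Fixpoint kiter (n : nat) : R.-spker T ~> T :=
  if n is m.+1 then mkcomp_noparam (kiter m) P
  else kdirac (@measurable_id _ T setT).

Definition invariant_measure (mu : {measure set T -> \bar R}) : Prop :=
  forall A, measurable A -> \int[mu]_x P x A = mu A.

End kernel_iterates.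

(* The equation says that [P (Xn n) B] is a version of the conditional
   probability of [Xn n.+1 \in B] given the sigma-algebra generated by
   [Xn 0], ..., [Xn n]. *)
Definition markov_chain d d' (Omega : measurableType d) (T : measurableType d')
    (R : realType) (Pr : probability Omega R) (P : R.-pker T ~> T)
    (Xn : nat -> {RV Pr >-> T}) : Prop :=
  forall (n : nat) (A : set Omega) (B : set T),
    g_sigma_preimage (fun i : 'I_n.+1 => Xn i : Omega -> T) A ->
    measurable B ->
    Pr (A `&` Xn n.+1 @^-1` B) = \int[Pr]_(w in A) P (Xn n w) B.

Definition empirical_measure d (T : measurableType d) (R : realType)
    (x : nat -> T) (n : nat) : {measure set T -> \bar R} :=
  mscale ((n%:R^-1 : R)%:nng)%R (msum (fun i => dirac (x i.+1)) n).

(* Meaningful when [nu `<< rho]; otherwise the derivative is a dummy function. *)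
Definition rel_entropy d (T : measurableType d) (R : realType)
    (nu rho : probability T R) : \bar R :=
  \int[nu]_x lne (('d (charge_of_finite_measure nu) '/d rho) x).

Section polish.
Context (R : realType) (X : polishMetricType R).
Implicit Types m : {measure set (borel X) -> \bar R}.

Definition in_P1 m : Prop :=
  m setT = 1 /\ exists x0 : X, \int[m]_x (@mdist R X x0 x)%:E < +oo.

Definition coupling m1 m2 : set (probability (borel X * borel X)%type R) :=
  [set pi | forall A : set (borel X), measurable A ->
      pi (fst @^-1` A) = m1 A /\ pi (snd @^-1` A) = m2 A].

Definition W1 m1 m2 : \bar R :=
  ereal_inf [set \int[pi]_z (@mdist R X z.1 z.2)%:E | pi in coupling m1 m2].

Definition T1 (C : R) (rho : probability (borel X) R) : Prop :=
  in_P1 rho /\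
  forall nu : probability (borel X) R, nu `<< rho ->
    W1 rho nu <= sqrte ((2 * C)%R%:E * rel_entropy nu rho).

Definition Lip1 : set (X -> R) :=
  [set f | forall x y, (`|f x - f y| <= mdist x y)%R].

(* The supremum is taken in [0, +oo], so it is 0 when S is empty. *)
Definition dS (S : set (X -> R)) m1 m2 : \bar R :=
  maxe 0 (ereal_sup
    [set `|\int[m1]_x (f x)%:E - \int[m2]_x (f x)%:E| | f in S]).

End polish.

(* Main.v *)
Require Import Defs.
From HB Require Import structures.
From mathcomp Require Import all_boot all_order all_algebra.
From mathcomp Require Import all_classical all_reals all_analysis.
From mathcomp Require Import measurable_realfun ring lra.

(** The distance [d_S(mu, mu_n)] is a function [F] of the path
    [X_0, ..., X_n]. By the triangle inequality it is Lipschitz in each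
    coordinate separately, with weight [1/n] in each of [X_1, ..., X_n] and
    weight [0] in [X_0]. The theorem is thus an instance of concentration for
    Lipschitz functionals of the path of a contracting chain.

    The engine is the Laplace transform. Testing [T1(C)] for [rho] against the
    measure with density proportional to [e^g] and using the easy half of
    Kantorovich duality gives, for [g] Lipschitz with constant [b],
    [int e^g drho <= exp (rho(g) + C b^2 / 2)] (lemma [T1_laplace]).

    This is tensorised along the chain by conditioning on the last coordinate
    first. If [G] depends on [X_0, ..., X_(k+1)] with weight [b] in the last
    one, integrating [X_(k+1)] against [P (X_k, .)] costs a factor
    [exp (C b^2 / 2)] and leaves a functional of [X_0, ..., X_k]. The weights
    of the first [k] coordinates are unchanged, while that of [X_k] becomes
    [a_k + kappa b]: [X_k] acts both directly and through the law of [X_(k+1)],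
    and [P] contracts Lipschitz constants by [kappa]
    ([chain_lipschitz_kernel_avg]). Induction gives
    [E e^G <= exp (E G + (C / 2) V)], where [V] is the sum of the squares of
    the weights met on the way ([chain_laplace]).

    For [F] these weights are [1/n] at time [n], at most [1/(n(1 - kappa))] at
    the times [1, ..., n - 1] by summing a geometric series, and at most
    [kappa/(n(1 - kappa))] at time [0]. The initial law thus contributes an
    extra term, but [(1 - kappa)^2 + kappa^2 <= 1], so that the terms of times
    [n] and [0] together cost no more than one full step and
    [V <= 1/(n (1 - kappa)^2)] ([path_variance_uniform_le]). Applying this to
    [lambda F] and optimising the exponential Markov inequality in [lambda]
    yields the bound.

    Measurability is not automatic, as [S] may be uncountable; it follows from
    continuity and separability ([measurable_coord_lipschitz]). *)

Set Implicit Arguments.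
Unset Strict Implicit.
Unset Printing Implicit Defensive.

Import Order.TTheory GRing.Theory Num.Theory.
Import numFieldNormedType.Exports.

Local Open Scope classical_set_scope.
Local Open Scope ring_scope.

(** * Lipschitz functionals of sequences *)

Lemma measurable_fun_sublevel d (Z : measurableType d) (R : realType)
    (f : Z -> R) :
  (forall r, measurable [set z | f z < r]) -> measurable_fun setT f.
Proof.
move=> mf; apply: (measurability _ (RGenInftyO.measurableE R)).
move=> _ [_ [r ->] <-]; rewrite setTI.
rewrite (_ : _ @^-1` _ = [set z | f z < r]); first exact: mf.
by apply/seteqP; split => z /=; rewrite in_itv.
Qed.

Section lipschitz.
Context (R : realType) (X : polishMetricType R).
Local Notation dist := (@mdist R X).

Lemma measurable_mdistr (c : X) : measurable_fun [set: borel X] (dist c).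
Proof.
apply: measurable_fun_sublevel => r; apply: sub_sigma_algebra.
rewrite openE => x /= cx; apply/nbhs_ballP.
exists (r - dist c x) => /=; first by rewrite subr_gt0.
move=> y; rewrite ballEmdist /= ltrBrDl; apply: le_lt_trans.
exact: metric_triangle.
Qed.

Lemma dense_sequence :
  exists u : nat -> X,
    forall (x : X) (e : R), 0 < e -> exists n, dist x (u n) < e.
Proof.
have [D cD dD] := @separable _ X.
have [D0|[u]] := pfcard_geP cD.
  have [||x []] := dD setT; [by exists point|exact: openT|].
  by rewrite D0.
exists u => x e e0.
have [||y [xy Dy]] := dD (ball x e)^°.
- by exists x; exact: nbhsx_ballx.
- exact: open_interior.
have [n _ un] := 'surj_u Dy.
by exists n; rewrite un; move/interior_subset: xy; rewrite ballEmdist.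
Qed.

(** Such a [G] depends on the first [m] coordinates only. Sequences indexed by
    [nat] avoid casts between tuples of different lengths when a coordinate is
    integrated out. *)
Definition coord_lipschitz (m : nat) (a : nat -> R) (G : (nat -> X) -> R) :=
  forall x y, `|G x - G y| <= \sum_(i < m) a i * dist (x i) (y i).

Lemma coord_lipschitz_le m a G x y : coord_lipschitz m a G ->
  G x <= G y + \sum_(i < m) a i * dist (x i) (y i).
Proof. by move=> /(_ x y) /ler_normlW; rewrite lerBlDl. Qed.

(** The Borel sets of [X^m] are those of the product sigma-algebra because [X]
    is separable. Concretely, [G] is the infimum of the functions
    [x |-> G s + sum_i a_i d(x_i, s_i)] over the countably many sequences [s]
    drawn from a dense set, and each of these is measurable. *)
Lemma measurable_coord_lipschitz d (Z : measurableType d) m a G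
    (Y : nat -> Z -> borel X) :
  (forall i, (i < m)%N -> 0 <= a i) -> coord_lipschitz m a G ->
  (forall i, (i < m)%N -> measurable_fun setT (Y i)) ->
  measurable_fun setT (fun z => G (Y ^~ z)).
Proof.
move=> a0 GL mY; have [u u_dense] := dense_sequence.
(* A number codes a finite list of indices into the dense sequence; past the
   end of the list the default index 0 is harmless, as [G] ignores it. *)
pose s n i := u (nth 0%N (odflt [::] (unpickle n : option (seq nat))) i).
pose D n z := \sum_(i < m) a i * dist (s n i) (Y i z).
have mD n : measurable_fun setT (D n).
  apply: measurable_sum => i; apply: measurable_funM => //.
  apply: (measurableT_comp (measurable_mdistr (s n i))).
  exact: mY.
apply: measurable_fun_sublevel => r.
rewrite (_ : [set z | _] = \bigcup_n [set z | G (s n) + D n z < r]); last first.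
  apply/seteqP; split => z /=; last first.
    move=> [n _ /=]; apply: le_lt_trans.
    rewrite /D; under eq_bigr do rewrite metric_sym.
    exact: coord_lipschitz_le.
  move=> Gr; pose A := \sum_(i < m) a i.
  have A0 : 0 <= A by apply: sumr_ge0 => i _; exact: a0.
  (* The approximation costs at most [A * e] twice, once in the weighted sum
     and once in [G (s n)]. *)
  pose e := (r - G (Y ^~ z)) / (2 * (A + 1)).
  have e0 : 0 < e by rewrite divr_gt0 ?subr_gt0// mulr_gt0// ltr_wpDl.
  have /choice[k kP] : forall i, exists n, dist (Y i z) (u n) < e.
    by move=> i; exact: u_dense.
  exists (pickle (mkseq k m)) => //=.
  set n := pickle _.
  have sE (i : 'I_m) : s n i = u (k i).
    by rewrite /s /n pickleK /= nth_mkseq.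
  have De : D n z <= A * e.
    rewrite /D /A mulr_suml; apply: ler_sum => i _.
    by rewrite ler_wpM2l ?a0// sE metric_sym ltW.
  have := coord_lipschitz_le (s n) (Y ^~ z) GL.
  have Ae : 2 * (A * e) + 2 * e = r - G (Y ^~ z).
    by rewrite /e; field; rewrite gt_eqF// ltr_wpDl.
  move: De; rewrite /D /=; set S := \sum_(i < m) _.
  lra.
apply: bigcupT_measurable => n.
have /(_ measurableT (`]-oo, r[%classic)) :=
  measurable_funD (measurable_cst (G (s n))) (mD n).
move=> /(_ (measurable_itv _)); rewrite setTI.
by congr measurable; apply/seteqP; split=> z /=; rewrite in_itv.
Qed.

End lipschitz.

(** * Kantorovich duality, the easy half *)

Section wasserstein_duality.
Context (R : realType) (X : polishMetricType R).
Local Notation dist := (@mdist R X).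
Implicit Types (f : X -> R) (b : R).

Definition lipschitz_with b f := forall x y, `|f x - f y| <= b * dist x y.

Lemma measurable_lipschitz b f : 0 <= b -> lipschitz_with b f ->
  measurable_fun [set: borel X] f.
Proof.
move=> b0 fL; pose G (s : nat -> X) := f (s 0%N).
apply: (@measurable_coord_lipschitz _ _ _ _ 1 (fun=> b) G (fun _ z => z)) => //.
by move=> x y; rewrite big_ord_recl big_ord0 addr0; exact: fL.
Qed.

Lemma measurable_mdist :
  measurable_fun [set: (borel X * borel X)%type] (fun z => dist z.1 z.2).
Proof.
pose G (s : nat -> X) := dist (s 0%N) (s 1%N).
pose Y (i : nat) (z : borel X * borel X) := if i is 0%N then z.1 else z.2.
apply: (@measurable_coord_lipschitz _ _ _ _ 2 (fun=> 1) G Y) => //.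
  move=> x y; rewrite !big_ord_recl big_ord0 /= addr0 !mul1r /G.
  have := metric_triangle (x 0%N) (y 0%N) (x 1%N).
  have := metric_triangle (y 0%N) (y 1%N) (x 1%N).
  have := metric_triangle (y 0%N) (x 0%N) (y 1%N).
  have := metric_triangle (x 0%N) (x 1%N) (y 1%N).
  rewrite (metric_sym (y 1%N)) (metric_sym (y 0%N) (x 0%N)) ler_norml.
  by move=> *; apply/andP; split; lra.
by move=> [|i] _; [exact: measurable_fst|exact: measurable_snd].
Qed.

Lemma lipschitz_integrable (m : probability (borel X) R) b f :
  in_P1 m -> 0 <= b -> lipschitz_with b f -> m.-integrable setT (EFin \o f).
Proof.
move=> [_ [x0 mx0]] b0 fL.
have mf := measurable_lipschitz b0 fL.
have id : m.-integrable setT (EFin \o dist x0).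
  apply/integrableP; split.
    apply/measurable_EFinP; exact: measurable_mdistr.
  apply: le_lt_trans mx0; rewrite le_eqVlt; apply/orP; left; apply/eqP.
  by apply: eq_integral => x _ /=; rewrite ger0_norm// mdist_ge0.
have ig : m.-integrable setT
    (fun x => `|f x0|%:E + b%:E * (EFin \o dist x0) x)%E.
  apply: integrableD => //; last exact: integrableZl.
  exact: finite_measure_integrable_cst.
apply: (le_integrable measurableT _ _ ig); first exact/measurable_EFinP.
move=> x _; rewrite /= lee_fin.
apply: le_trans (ler_norm _).
have := fL x0 x; have := lerB_dist (f x) (f x0); rewrite distrC; lra.
Qed.

Lemma integral_marginal d d' (Z : measurableType d) (Y : measurableType d')
    (pi : {measure set Z -> \bar R}) (m : {measure set Y -> \bar R})
    (p : Z -> Y) (f : Y -> \bar R) :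
  measurable_fun setT p ->
  (forall A, measurable A -> pi (p @^-1` A) = m A) ->
  m.-integrable setT f ->
  pi.-integrable setT (f \o p) /\
  (\int[pi]_z f (p z) = \int[m]_y f y)%E.
Proof.
move=> mp pm fi.
have mf := measurable_int _ fi.
have E (g : Y -> \bar R) :
    (\int[m]_y g y = \int[pushforward pi p]_y g y)%E.
  apply: eq_measure_integral => A mA _; exact: esym (pm _ mA).
have fpi : pi.-integrable setT (f \o p).
  apply/integrableP; split; first exact: measurableT_comp.
  move/integrableP : fi => [_]; rewrite E ge0_integral_pushforward//.
  exact: measurableT_comp.
by split => //; rewrite E integral_pushforward.
Qed.

(** Integrate [|f z.1 - f z.2| <= b d(z.1, z.2)] against a nearly optimal
    coupling. Integrability is assumed rather than derived from a first moment,
    so that the lemma applies to tilted measures. *)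
Lemma W1_dual_le (m1 m2 : {measure set (borel X) -> \bar R}) w b f :
  (W1 m1 m2 <= w%:E)%E -> 0 <= b -> lipschitz_with b f ->
  m1.-integrable setT (EFin \o f) -> m2.-integrable setT (EFin \o f) ->
  `|Rintegral m1 setT f - Rintegral m2 setT f| <= b * w.
Proof.
move=> Ww b0 fL f1 f2.
have step e : 0 < e ->
    `|Rintegral m1 setT f - Rintegral m2 setT f| <= b * (w + e).
  move=> e0; have : (W1 m1 m2 < (w + e)%:E)%E.
    by apply: le_lt_trans Ww _; rewrite lte_fin ltrDl.
  move=> /ereal_inf_lt[_ [pi cpi <-] piw].
  have [i1 E1] :=
    integral_marginal measurable_fst (fun A mA => (cpi A mA).1) f1.
  have [i2 E2] :=
    integral_marginal measurable_snd (fun A mA => (cpi A mA).2) f2.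
  rewrite /Rintegral -E1 -E2 -fineB; [|exact: integrable_fin_num..].
  rewrite -integralB//; set I := integral _ _ _.
  have fI : I \is a fin_num.
    by apply: integrable_fin_num => //; exact: integrableB.
  rewrite -lee_fin -abse_EFin fineK//.
  apply: le_trans (le_abse_integral _ _ _) _ => //.
    exact: measurable_int (integrableB _ i1 i2).
  apply: (@le_trans _ _ (\int[pi]_z (b%:E * (dist z.1 z.2)%:E))%E).
    apply: ge0_le_integral => //.
    - apply: measurableT_comp => //.
      exact: measurable_int (integrableB _ i1 i2).
    - apply: measurable_funeM; apply/measurable_EFinP; exact: measurable_mdist.
    - move=> z _ /=; rewrite lee_fin; exact: fL.
  rewrite ge0_integralZl_EFin//.
  - by rewrite EFinM lee_wpmul2l ?lee_fin// ltW.
  - by move=> z _; rewrite lee_fin mdist_ge0.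
  - apply/measurable_EFinP; exact: measurable_mdist.
apply/ler_addgt0Pr => e e0.
apply: le_trans (step (e / (b + 1)) _) _.
  by rewrite divr_gt0// ltr_wpDl.
rewrite mulrDr lerD2l mulrCA ger_pMr// ler_pdivrMr ?mul1r ?lerDl//.
by rewrite ltr_wpDl.
Qed.

(** Measures are functions on all sets, so that measures agreeing on measurable
    sets need not be equal; [W1] sees them through couplings, which are only
    constrained on measurable sets. *)
Lemma eq_W1 (m1 m1' m2 m2' : {measure set (borel X) -> \bar R}) :
  (forall A, measurable A -> m1 A = m1' A) ->
  (forall A, measurable A -> m2 A = m2' A) ->
  W1 m1 m2 = W1 m1' m2'.
Proof.
move=> E1 E2; rewrite /W1; congr (ereal_inf (image _ _)).
apply/seteqP; split => pi cpi A mA; have [c1 c2] := cpi _ mA.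
  by rewrite c1 c2 E1 ?E2.
by rewrite c1 c2 E1 ?E2.
Qed.

Lemma kiter1E (P : R.-pker (borel X) ~> (borel X)) x A : measurable A ->
  kiter P 1 x A = P x A.
Proof.
move=> mA; rewrite /= /mkcomp_noparam /kcomp_noparam.
rewrite integral_dirac ?diracT ?mul1e//.
exact: measurable_kernel.
Qed.

(** The dual form of the contraction hypothesis, for the one-step kernel. *)
Lemma kernel_contraction (P : R.-pker (borel X) ~> (borel X)) kappa b f :
  (forall x y, W1 (kiter P 1 x) (kiter P 1 y) <= (kappa * dist x y)%:E)%E ->
  (forall x, in_P1 (kernel_at P x)) ->
  0 <= b -> lipschitz_with b f ->
  lipschitz_with (kappa * b) (fun x => Rintegral (kernel_at P x) setT f).
Proof.
move=> Pk P1 b0 fL x y; rewrite [kappa * b]mulrC -mulrA.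
apply: (W1_dual_le _ b0 fL).
- have <- : W1 (kiter P 1 x) (kiter P 1 y) =
      W1 (kernel_at P x) (kernel_at P y).
    by apply: eq_W1 => A; exact: kiter1E.
  exact: Pk.
- exact: (lipschitz_integrable (P1 _) b0 fL).
- exact: (lipschitz_integrable (P1 _) b0 fL).
Qed.

End wasserstein_duality.

(** * The Laplace transform under a transportation inequality *)

Lemma Rintegral_probability_cst d (T : measurableType d) (R : realType)
    (m : probability T R) (r : R) : Rintegral m setT (fun=> r) = r.
Proof.
transitivity (r * fine (m setT)); first exact: Rintegral_cst.
by rewrite probability_setT mulr1.
Qed.

Lemma bounded_integrable d (T : measurableType d) (R : realType)
    (m : probability T R) (f : T -> R) (M : R) :
  measurable_fun setT f -> (forall x, `|f x| <= M) ->
  m.-integrable setT (EFin \o f).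
Proof.
move=> mf fM.
apply: (@le_integrable _ _ _ m setT measurableT _ (cst M%:E)).
- exact/measurable_EFinP.
- move=> x _; rewrite /= lee_fin; exact: le_trans (fM x) (ler_norm _).
- exact: finite_measure_integrable_cst.
Qed.

Section exponential_density.
Local Open Scope ereal_scope.
Local Open Scope charge_scope.
Context d (T : measurableType d) (R : realType) (rho : probability T R).
Variable g : T -> R.
Hypothesis mg : measurable_fun setT g.
Hypothesis g1 : \int[rho]_x (expR (g x))%:E = 1.

(** The probability measure [e^g rho]. The two proofs are arguments, so that the
    measure structures can be inferred from the term. *)
Definition exp_density (_ : measurable_fun setT g)
    (_ : \int[rho]_x (expR (g x))%:E = 1) (A : set T) : \bar R :=
  \int[rho]_(x in A) (expR (g x))%:E.

Local Notation nu := (exp_density mg g1).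

Let mexpg : measurable_fun setT (fun x => (expR (g x))%:E).
Proof. by apply/measurable_EFinP; exact: measurableT_comp. Qed.

Let nu0 : nu set0 = 0. Proof. exact: integral_set0. Qed.

Let nu_ge0 A : 0 <= nu A.
Proof. by apply: integral_ge0 => x _; rewrite lee_fin expR_ge0. Qed.

Let nu_sigma_additive : semi_sigma_additive nu.
Proof.
move=> F mF tF mUF; rewrite /exp_density ge0_integral_bigcup//; last first.
  exact: measurable_funTS.
by apply: is_cvg_ereal_nneg_natsum => n _; exact: nu_ge0.
Qed.

HB.instance Definition _ :=
  isMeasure.Build _ _ _ nu nu0 nu_ge0 nu_sigma_additive.

HB.instance Definition _ := Measure_isProbability.Build _ _ _ nu g1.

Lemma exp_density_dominates : nu `<< rho.
Proof.
apply/null_content_dominatesP => A mA A0.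
by apply: null_set_integral => //; exact: measurable_funTS.
Qed.

Lemma Radon_Nikodym_exp_density :
  ae_eq rho setT ('d (charge_of_finite_measure nu) '/d rho)
                 (fun x => (expR (g x))%:E).
Proof.
apply: integral_ae_eq => //.
  apply: Radon_Nikodym_integrable; exact: exp_density_dominates.
move=> A _ mA; rewrite -Radon_Nikodym_integral//.
exact: exp_density_dominates.
Qed.

Lemma integral_exp_density f : nu.-integrable setT f ->
  \int[nu]_x f x = \int[rho]_x (f x * (expR (g x))%:E).
Proof.
move=> fi.
rewrite -(@Radon_Nikodym_change_of_variables _ _ _ _ rho)//; last first.
  exact: exp_density_dominates.
have mf := measurable_int _ fi.
apply: ae_eq_integral => //.
- apply: emeasurable_funM => //.
  apply: (measurable_int rho); apply: Radon_Nikodym_integrable.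
  exact: exp_density_dominates.
- exact: emeasurable_funM.
- apply: ae_eqe_mul2l; exact: Radon_Nikodym_exp_density.
Qed.

(** By uniqueness of the Radon-Nikodym derivative the entropy integrand is [g],
    almost everywhere for [rho], hence for [nu]. *)
Lemma rel_entropy_exp_density :
  rel_entropy nu rho = \int[nu]_x (g x)%:E.
Proof.
pose h x := fine (('d (charge_of_finite_measure nu) '/d rho) x).
have RNE x : ('d (charge_of_finite_measure nu) '/d rho) x = (h x)%:E.
  by rewrite fineK// Radon_Nikodym_fin_num//; exact: exp_density_dominates.
have mh : measurable_fun setT h.
  apply/measurable_EFinP.
  rewrite (_ : EFin \o h = 'd (charge_of_finite_measure nu) '/d rho).
    apply: (measurable_int rho); apply: Radon_Nikodym_integrable.
    exact: exp_density_dominates.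
  by apply/funext => x; rewrite RNE.
rewrite /rel_entropy; apply: ae_eq_integral => //.
- under eq_fun do rewrite RNE.
  apply: measurable_fun_ifT => //.
  + exact: measurable_fun_ler.
  + by apply/measurable_EFinP; exact: measurableT_comp.
- exact/measurable_EFinP.
- apply: null_dominates_ae_eq exp_density_dominates _ => //.
  apply: filterS Radon_Nikodym_exp_density => x /= RNx /RNx ->.
  by rewrite lne_EFin ?expR_gt0// expRK.
Qed.

End exponential_density.

Lemma le_mul_expR (R : realType) (u : R) : expR u - 1 <= u * expR u.
Proof.
have := expR_ge1Dx (- u); rewrite -(ler_pM2r (expR_gt0 u)) -expRD addNr expR0.
by rewrite mulrDl mul1r; lra.
Qed.

(** This is the nonnegativity of the relative entropy of [e^g m], read off from
    [u e^u >= e^u - 1]. *)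
Lemma Rintegral_exp_density_ge0 d (T : measurableType d) (R : realType)
    (m : probability T R) (g : T -> R) (mg : measurable_fun setT g)
    (g1 : (\int[m]_x (expR (g x))%:E = 1)%E) (M : R) :
  (forall x, `|g x| <= M) ->
  0 <= Rintegral (exp_density mg g1) setT g.
Proof.
move=> gM; rewrite /Rintegral integral_exp_density; last first.
  exact: bounded_integrable gM.
have eM x : `|expR (g x)| <= expR M.
  rewrite ger0_norm ?expR_ge0// ler_expR.
  exact: le_trans (ler_norm _) (gM x).
have me : measurable_fun setT (expR \o g) by exact: measurableT_comp.
have ie := bounded_integrable m me eM.
rewrite -/(Rintegral m setT (fun x => g x * expR (g x))).
have <- : Rintegral m setT (fun x => expR (g x) - 1) = 0.
  rewrite RintegralB//; last exact: finite_measure_integrable_cst.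
  by rewrite /Rintegral g1 integral_cst//= probability_setT mule1 subrr.
apply: le_Rintegral => //.
- apply: (@bounded_integrable _ _ _ _ _ (expR M + 1)).
    exact: measurable_funB.
  by move=> x; apply: le_trans (ler_normB _ _) _; rewrite normr1 lerD2r.
- apply: (@bounded_integrable _ _ _ _ _ (M * expR M)).
    exact: measurable_funM.
  by move=> x; rewrite normrM ler_pM.
- by move=> x _; exact: le_mul_expR.
Qed.

Section transport_laplace.
Context (R : realType) (X : polishMetricType R).

(** With [z = rho(e^g)] and [nu = e^(g - ln z) rho], the entropy of [nu] is
    [h = nu(g) - ln z], so
    [ln z = nu(g) - h <= rho(g) + b sqrt (2 C h) - h <= rho(g) + C b^2 / 2]. *)
Lemma T1_laplace_bounded (rho : probability (borel X) R) C b g (M : R) :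
  0 < C -> T1 C rho -> 0 <= b -> lipschitz_with b g ->
  (forall x, `|g x| <= M) ->
  (\int[rho]_x (expR (g x))%:E <=
   (expR (Rintegral rho setT g + C * b ^+ 2 / 2))%:E)%E.
Proof.
move=> C0 [rhoP1 rhoT1] b0 gL gM.
have mg := measurable_lipschitz b0 gL.
have eM x : `|expR (g x)| <= expR M.
  rewrite ger0_norm ?expR_ge0// ler_expR.
  exact: le_trans (ler_norm _) (gM x).
have me : measurable_fun [set: borel X] (expR \o g) by exact: measurableT_comp.
have ie := @bounded_integrable _ (borel X) _ rho _ _ me eM.
pose z := Rintegral rho setT (expR \o g).
have zE : (\int[rho]_x (expR (g x))%:E = z%:E)%E.
  by rewrite fineK//; exact: integrable_fin_num.
have z0 : 0 < z.
  apply: (@lt_le_trans _ _ (expR (- M))); first exact: expR_gt0.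
  have -> : expR (- M) = Rintegral rho setT (fun=> expR (- M)).
    by exact/esym/Rintegral_probability_cst.
  apply: le_Rintegral => //; first exact: finite_measure_integrable_cst.
  by move=> x _; rewrite ler_expR; have := gM x; rewrite ler_norml => /andP[].
pose g' x := g x - ln z.
have mg' : measurable_fun [set: borel X] g' by exact: measurable_funB.
have g'M x : `|g' x| <= M + `|ln z|.
  by apply: le_trans (ler_normB _ _) _; rewrite lerD2r.
have g'1 : (\int[rho]_x (expR (g' x))%:E = 1)%E.
  rewrite (_ : (fun x => _) = fun x => (z^-1%:E * (expR (g x))%:E)%E).
    rewrite integralZl// zE -EFinM mulVf//; exact: lt0r_neq0.
  apply/funext => x; rewrite -EFinM expRD -lnV// lnK 1?mulrC//.
  by rewrite posrE invr_gt0.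
pose nu : probability (borel X) R := exp_density mg' g'1.
have := rhoT1 nu (exp_density_dominates mg' g'1).
rewrite rel_entropy_exp_density.
have g'i : nu.-integrable setT (EFin \o g').
  exact: (bounded_integrable nu mg' g'M).
have gi : nu.-integrable setT (EFin \o g).
  exact: (bounded_integrable nu mg gM).
pose h := Rintegral nu setT g'.
have h0 : 0 <= h by exact: (Rintegral_exp_density_ge0 mg' g'1 g'M).
have -> : (\int[nu]_x (g' x)%:E = h%:E)%E.
  by rewrite fineK//; exact: integrable_fin_num.
rewrite -EFinM /= => /W1_dual_le /(_ b0 gL) dual.
have {dual} := dual (bounded_integrable rho mg gM) gi.
have hE : h = Rintegral nu setT g - ln z.
  rewrite /h RintegralB//; last exact: finite_measure_integrable_cst.
  by congr (_ - _); exact: Rintegral_probability_cst.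
move=> /ler_normlP[+ _]; rewrite opprB => dual.
rewrite zE lee_fin -[leLHS]lnK ?posrE// ler_expR; move: dual.
(* The last inequality of the chain is [(C b - s)^2 >= 0]. *)
set s := Num.sqrt _.
have : s ^+ 2 = 2 * C * h by rewrite sqr_sqrtr// mulr_ge0// mulr_ge0// ltW.
have : 0 <= (C * b - s) ^+ 2 by rewrite sqr_ge0.
rewrite {}hE; set A := Rintegral nu _ _; set B := Rintegral _ _ _ => sq s2 AB.
suff : 2 * C * ln z <= 2 * C * (B + C * b ^+ 2 / 2)
  by rewrite ler_pM2l// mulr_gt0.
have : 2 * C * (A - B) <= 2 * C * (b * s)
  by rewrite ler_pM2l// mulr_gt0.
move: sq s2; set l := ln z; rewrite !expr2; nra.
Qed.

Lemma lipschitz_min b (g : X -> R) c : lipschitz_with b g ->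
  lipschitz_with b (fun x => Order.min (g x) c).
Proof.
move=> gL x y; apply: le_trans (gL x y).
by case: (leP (g x) c); case: (leP (g y) c); rewrite !ler_normr !ler_norml;
  case: (leP 0 (g x - g y)); lra.
Qed.

(** Truncating [g] from above preserves its Lipschitz constant and does not
    increase its mean, so the bounded case passes to the limit by monotone
    convergence. Nonnegativity of [g] makes one-sided truncation enough. *)
Lemma T1_laplace (rho : probability (borel X) R) C b (g : X -> R) :
  0 < C -> T1 C rho -> 0 <= b -> lipschitz_with b g -> (forall x, 0 <= g x) ->
  (\int[rho]_x (expR (g x))%:E <=
   (expR (Rintegral rho setT g + C * b ^+ 2 / 2))%:E)%E.
Proof.
move=> C0 rhoT1 b0 gL g0.
pose gn (n : nat) x := Order.min (g x) n%:R.
have gnL n : lipschitz_with b (gn n) by exact: lipschitz_min.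
have mgn n := measurable_lipschitz b0 (gnL n).
have gn0 n x : 0 <= gn n x by rewrite le_min g0 ler0n.
have rhoP1 := rhoT1.1.
pose E n x := (expR (gn n x))%:E.
have mE n : measurable_fun [set: borel X] (E n).
  by apply/measurable_EFinP; exact: measurableT_comp.
have E0 n x : [set: borel X] x -> (0 <= E n x)%E.
  by move=> _; rewrite lee_fin expR_ge0.
have Eh x : [set: borel X] x -> {homo E^~ x : n m / (n <= m)%N >-> (n <= m)%E}.
  move=> _ n m nm; rewrite lee_fin ler_expR le_min ge_min lexx/=.
  by rewrite ge_min ler_nat nm orbT.
have -> : (\int[rho]_x (expR (g x))%:E = \int[rho]_x (limn (E^~ x)))%E.
  apply: eq_integral => x _; apply/esym/cvg_lim => //.
  apply: cvg_near_cst; near=> n; rewrite /E /gn min_l//.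
  by near: n; exact: nbhs_infty_ger.
rewrite (monotone_convergence _ _ mE)//.
apply: lime_le.
  apply: ereal_nondecreasing_is_cvgn => n m nm; apply: ge0_le_integral => //.
    by move=> x; exact: E0.
  by move=> x _; exact: Eh.
apply: nearW => n.
apply: (@le_trans _ _ (expR (Rintegral rho setT (gn n) + C * b ^+ 2 / 2))%:E).
  apply: (@T1_laplace_bounded rho C b (gn n) n%:R) => //.
  by move=> x; rewrite ger0_norm// ge_min lexx orbT.
rewrite lee_fin ler_expR lerD2r; apply: le_Rintegral => //.
- exact: (lipschitz_integrable rhoP1 b0 (gnL n)).
- exact: (lipschitz_integrable rhoP1 b0 gL).
- by move=> x _; rewrite ge_min lexx.
Unshelve. all: by end_near. Qed.

End transport_laplace.

(** * Disintegration along a kernel *)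

Section kernel_pullback.
Context d d' d'' (T : measurableType d) (Z : measurableType d')
  (W : measurableType d'') (R : realType).
Variables (g : T -> Z) (K : R.-pker Z ~> W).

Definition kernel_pullback (_ : measurable_fun setT g) :
  T -> {measure set W -> \bar R} := K \o g.

Hypothesis mg : measurable_fun setT g.

Let measurable_kernel_pullback U : measurable U ->
  measurable_fun setT (kernel_pullback mg ^~ U).
Proof.
by move=> mU; exact: (measurableT_comp (measurable_kernel K U mU) mg).
Qed.

HB.instance Definition _ := isKernel.Build _ _ _ _ _ (kernel_pullback mg)
  measurable_kernel_pullback.

Let kernel_pullback_prob x : kernel_pullback mg x setT = 1%E.
Proof. exact: prob_kernel. Qed.

HB.instance Definition _ := Kernel_isProbability.Build _ _ _ _ _
  (kernel_pullback mg) kernel_pullback_prob.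

End kernel_pullback.

Section disintegration.
Local Open Scope ereal_scope.
Context d dz dw (Omega : measurableType d) (Z : measurableType dz)
  (W : measurableType dw) (R : realType) (Pr : probability Omega R).
Variables (Y : Omega -> Z) (V : Omega -> W) (K : R.-pker Z ~> W).
Hypotheses (mY : measurable_fun setT Y) (mV : measurable_fun setT V).
Hypothesis K_rect : forall A B, measurable A -> measurable B ->
  Pr (Y @^-1` A `&` V @^-1` B) = \int[Pr]_(w in Y @^-1` A) K (Y w) B.

(** Both sides, as functionals of [H], are integrals against measures on
    [Z * W]; these agree on rectangles by hypothesis, and rectangles determine a
    finite measure. *)
Lemma integral_disintegration (H : Z * W -> \bar R) :
  measurable_fun setT H -> (forall z, 0 <= H z) ->
  \int[Pr]_w H (Y w, V w) = \int[Pr]_w \int[K (Y w)]_v H (Y w, v).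
Proof.
move=> mH H0.
pose YV w := (Y w, V w).
have mYV : measurable_fun setT YV by exact: measurable_fun_pair.
(* The right-hand side is the integral against a composition of kernels, with
   [unit] as the source, which spares proving that it is a measure. *)
pose l : R.-sfker unit ~> Omega :=
  kprobability (measurable_cst (Pr : pprobability Omega R)).
have mYs : measurable_fun [set: unit * Omega] (fun z => Y z.2).
  exact: measurableT_comp.
pose f (z : (unit * Omega) * W) := (Y z.1.2, z.2).
have mf : measurable_fun setT f.
  apply: measurable_fun_pair => //.
  by apply: (measurableT_comp mYs).
pose k : R.-sfker (unit * Omega) ~> (Z * W)%type :=
  mkcomp (kernel_pullback K mYs) (@kdirac _ _ _ _ R f mf).
have kE w (G : Z * W -> \bar R) :
    measurable_fun setT G -> (forall z, 0 <= G z) ->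
    \int[k (tt, w)]_z G z = \int[K (Y w)]_v G (Y w, v).
  move=> mG G0; rewrite integral_kcomp//; apply: eq_integral => v _.
  by rewrite integral_dirac// diracT mul1e.
have measure_as_integral (m : {measure set (Z * W) -> \bar R}) D :
    measurable D -> m D = \int[m]_z (\1_D z)%:E.
  by move=> mD; rewrite integral_indic// setIT.
pose nu2 : {measure set (Z * W) -> \bar R} := mkcomp l k tt.
have nu2E G : measurable_fun setT G -> (forall z, 0 <= G z) ->
    \int[nu2]_z G z = \int[Pr]_w \int[K (Y w)]_v G (Y w, v).
  move=> mG G0; rewrite integral_kcomp//; apply: eq_integral => w _.
  exact: kE.
rewrite -nu2E// -(@ge0_integral_pushforward _ _ _ _ _ YV mYV Pr setT H)//.
pose C : set (set (Z * W)) :=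
  [set C | exists A, measurable A /\ exists B, measurable B /\ C = A `*` B].
apply: eq_measure_integral => D mD _.
apply: (measure_unique C (fun=> setT)) => //.
- rewrite measurable_prod_measurableType //; congr (<<s _ >>).
  rewrite predeqE; split => [[A mA [B mB <-]]|[A [mA [B [mB ->]]]]].
    by exists A; split => //; exists B.
  by exists A => //; exists B.
- move=> /= _ _ [X1 [mX1 [X2 [mX2 ->]]]] [Y1 [mY1 [Y2 [mY2 ->]]]].
  rewrite -setXI; exists (X1 `&` Y1); split; first exact: measurableI.
  by exists (X2 `&` Y2); split => //; exact: measurableI.
- move=> _; exists setT; split => //; exists setT; split => //.
  by rewrite setXTT.
- by rewrite bigcup_const//; exists 0%N.
- move=> _ [A [mA [B [mB ->]]]].
  have mAB : measurable (A `*` B) by exact: measurableX.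
  rewrite [RHS]measure_as_integral//.
  rewrite nu2E//; last first.
    by apply/measurable_EFinP; exact: measurable_indic.
  transitivity (Pr (Y @^-1` A `&` V @^-1` B)); first by [].
  rewrite K_rect// integral_mkcond; apply: eq_integral => w _.
  rewrite patchE; case: ifPn => wA.
    transitivity (\int[K (Y w)]_v (\1_B v)%:E).
      by rewrite integral_indic// setIT.
    apply: eq_integral => v _; rewrite !indicE; congr (_%:R%:E).
    congr nat_of_bool; apply/idP/idP; rewrite !inE /=; last by case.
    by move=> Bv; split => //; exact: set_mem wA.
  rewrite integral0_eq// => v _; rewrite indicE memNset//= => -[/= Aw _].
  by move/negP: wA; apply; exact: mem_set.
- move=> _; apply: (@le_lt_trans _ _ 1); last exact: ltry.
  by apply: probability_le1; rewrite -[X in measurable X]setTI; exact: mYV.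
Qed.

End disintegration.

(** * Functionals of a Markov chain *)

Definition upd (T : Type) (x : nat -> T) (j : nat) (y : T) : nat -> T :=
  fun i => if i == j then y else x i.

Section chain_functional.
Context (R : realType) (X : polishMetricType R).
Local Notation dist := (@mdist R X).
Implicit Types (a : nat -> R) (b : R) (G : (nat -> X) -> R).

Lemma updE (T : Type) (x : nat -> T) j y : upd x j y j = y.
Proof. by rewrite /upd eqxx. Qed.

Lemma upd_lt (T : Type) (x : nat -> T) j y i : (i < j)%N -> upd x j y i = x i.
Proof. by rewrite /upd; case: ltngtP. Qed.

(** A functional of the coordinates [0, ..., k]; the last weight is set apart
    because it is the one that the recursion over time modifies. *)
Definition chain_lipschitz k a b G := coord_lipschitz k.+1 (upd a k b) G.

Lemma chain_lipschitzP k a b G x y : chain_lipschitz k a b G ->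
  `|G x - G y| <= \sum_(i < k) a i * dist (x i) (y i) + b * dist (x k) (y k).
Proof.
move=> /(_ x y); rewrite big_ord_recr /= updE.
by under eq_bigr do rewrite upd_lt//.
Qed.

Lemma eq_coord_lipschitz m a G x y : coord_lipschitz m a G ->
  (forall i, (i < m)%N -> x i = y i) -> G x = G y.
Proof.
move=> /(_ x y) GL xy; apply/eqP; rewrite -subr_eq0 -normr_le0.
apply: le_trans GL _; rewrite big1// => i _.
by rewrite xy// mdistxx mulr0.
Qed.

Lemma lipschitz_upd k a b G x : chain_lipschitz k a b G ->
  lipschitz_with b (fun y => G (upd x k y)).
Proof.
move=> GL y z; apply: le_trans (chain_lipschitzP _ _ GL) _.
rewrite !updE big1 ?add0r// => i _.
by rewrite !upd_lt// mdistxx mulr0.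
Qed.

Variable P : R.-pker (borel X) ~> (borel X).

(** The conditional expectation of [G (X_0, ..., X_(k+1))] given
    [X_0, ..., X_k], as a functional of the path. *)
Definition kernel_avg k G (x : nat -> X) : R :=
  Rintegral (kernel_at P (x k)) setT (fun y => G (upd x k.+1 y)).

Lemma kernel_avg_ge0 k G : (forall x, 0 <= G x) ->
  forall x, 0 <= kernel_avg k G x.
Proof. by move=> G0 x; exact: Rintegral_ge0. Qed.

Variable kappa : R.
Hypothesis P_P1 : forall x, in_P1 (kernel_at P x).
Hypothesis P_contr :
  forall x y, (W1 (kiter P 1 x) (kiter P 1 y) <= (kappa * dist x y)%:E)%E.

(** Moving from [x] to [y] changes the integrand, which accounts for the weights
    [a], and the kernel [P (x k)], which moves the integral of a function with
    Lipschitz constant [b] by at most [kappa * b * d(x k, y k)]. *)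
Lemma chain_lipschitz_kernel_avg k a b G : 0 <= b ->
  chain_lipschitz k.+1 a b G ->
  chain_lipschitz k a (a k + kappa * b) (kernel_avg k G).
Proof.
move=> b0 GL x y; rewrite big_ord_recr /= updE.
under eq_bigr do rewrite upd_lt//.
pose f (u : nat -> X) z := G (upd u k.+1 z).
have fL u : lipschitz_with b (f u) by exact: lipschitz_upd GL.
have fi u c := lipschitz_integrable (P_P1 c) b0 (fL u).
pose S := \sum_(i < k.+1) a i * dist (x i) (y i).
have fS z : `|f x z - f y z| <= S.
  apply: le_trans (chain_lipschitzP _ _ GL) _.
  rewrite !updE mdistxx mulr0 addr0.
  by under eq_bigr do rewrite !upd_lt//.
have step1 : `|Rintegral (kernel_at P (x k)) setT (f x) -
               Rintegral (kernel_at P (x k)) setT (f y)| <= S.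
  rewrite -RintegralB; [|exact: measurableT|exact: fi|exact: fi].
  apply: le_trans (le_normr_Rintegral _ _) _ => //.
    exact: (integrableB measurableT (fi x (x k)) (fi y (x k))).
  rewrite -[leRHS](Rintegral_probability_cst (kernel_at P (x k))).
  apply: le_Rintegral => //.
  - apply: integrable_norm.
    exact: (integrableB measurableT (fi x (x k)) (fi y (x k))).
  - exact: finite_measure_integrable_cst.
  - by move=> z _; exact: fS.
have step2 := kernel_contraction P_contr P_P1 b0 (fL y) (x k) (y k).
have := lerD step1 step2; rewrite /S big_ord_recr /= -addrA -mulrDl.
by apply: le_trans; rewrite (le_trans _ (ler_normD _ _))// subrKA.
Qed.

Context d (Omega : measurableType d) (Pr : probability Omega R)
  (Xn : nat -> {RV Pr >-> borel X}) (Xn_markov : markov_chain P Xn).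

Local Notation path w := (fun i => Xn i w : X).

(** The Markov property, with the past gathered into one random tuple. *)
Lemma markov_history_rect k (A : set (k.+1.-tuple (borel X))) B :
  measurable A -> measurable B ->
  let hist w := [tuple Xn i w | i < k.+1] in
  (Pr (hist @^-1` A `&` Xn k.+1 @^-1` B) =
   \int[Pr]_(w in hist @^-1` A) P (Xn k w) B)%E.
Proof.
move=> mA mB hist; apply: Xn_markov => //.
rewrite (_ : (fun i : 'I_k.+1 => _) =
    (fun i => (tnth (T := borel X))^~ i \o hist)).
  by rewrite g_sigma_preimage_comp; exists A => //; rewrite setTI.
by apply/funext => i; apply/funext => w; rewrite /= tnth_mktuple.
Qed.

(** [phi] is the identity for the mean of [G], and the exponential for its
    Laplace transform. *)
Lemma integral_markov_step k a b G (phi : R -> R) :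
  (forall i, (i <= k)%N -> 0 <= a i) -> 0 <= b ->
  chain_lipschitz k.+1 a b G ->
  measurable_fun setT phi -> (forall x, 0 <= phi (G x)) ->
  (\int[Pr]_w (phi (G (path w)))%:E =
   \int[Pr]_w \int[kernel_at P (Xn k w)]_y
     (phi (G (upd (path w) k.+1 y)))%:E)%E.
Proof.
move=> a0 b0 GL mphi phi0.
pose hist w := [tuple Xn i w | i < k.+1].
have mhist : measurable_fun setT hist.
  apply/measurable_fun_tnthP => i; rewrite (_ : _ \o _ = Xn i)//.
  by apply/funext => w; rewrite /= tnth_mktuple.
pose last (h : k.+1.-tuple (borel X)) := tnth h ord_max.
have mlast : measurable_fun setT last by exact: measurable_tnth.
have lastE w : last (hist w) = Xn k w by rewrite /last tnth_mktuple.
(* Coordinates beyond the history take the default value [point]; [G] ignores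
   them. *)
pose H (z : (k.+1.-tuple (borel X) * borel X)%type) :=
  (phi (G (upd (nth point z.1) k.+1 z.2)))%:E.
have GE w y : G (upd (nth point (hist w)) k.+1 y) = G (upd (path w) k.+1 y).
  apply: (eq_coord_lipschitz GL) => i.
  rewrite ltnS leq_eqVlt => /orP[/eqP->|ik].
    by rewrite !updE.
  rewrite !upd_lt//; pose j := Ordinal ik.
  by rewrite -[i]/(val j) -tnth_nth tnth_mktuple.
have mH : measurable_fun setT H.
  apply/measurable_EFinP; apply: measurableT_comp => //.
  pose Y i (z : (k.+1.-tuple (borel X) * borel X)%type) : borel X :=
    upd (nth point z.1) k.+1 z.2 i.
  apply: (@measurable_coord_lipschitz _ _ _ _ k.+2 (upd a k.+1 b) G Y) => //.
    move=> i; rewrite ltnS leq_eqVlt => /orP[/eqP->|ik]; first by rewrite updE.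
    by rewrite upd_lt// a0.
  move=> i; rewrite ltnS leq_eqVlt => /orP[/eqP->|ik].
    by apply: eq_measurable_fun measurable_snd => z _; rewrite /Y updE.
  apply: (eq_measurable_fun (fun z => tnth z.1 (Ordinal ik))).
    by move=> z _; rewrite /Y upd_lt// (tnth_nth point).
  apply: (measurableT_comp (measurable_tnth (Ordinal ik))).
  exact: measurable_fst.
have hist_rect A B : measurable A -> measurable B ->
    (Pr (hist @^-1` A `&` Xn k.+1 @^-1` B) =
     \int[Pr]_(w in hist @^-1` A) kernel_pullback P mlast (hist w) B)%E.
  move=> mA mB; rewrite (markov_history_rect mA mB).
  by apply: eq_integral => w _; rewrite /kernel_pullback /comp lastE.
have mX : measurable_fun setT (Xn k.+1) by exact: measurable_funPT.
have H0 z : (0 <= H z)%E by rewrite lee_fin.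
transitivity (\int[Pr]_w H (hist w, Xn k.+1 w))%E.
  apply: eq_integral => w _; rewrite /H /= GE; congr (phi _)%:E.
  apply: (eq_coord_lipschitz GL) => i.
  rewrite ltnS leq_eqVlt => /orP[/eqP->|ik].
    by rewrite updE.
  by rewrite upd_lt.
rewrite (integral_disintegration mhist mX hist_rect mH H0).
apply: eq_integral => w _.
transitivity (\int[kernel_at P (last (hist w))]_y H (hist w, y))%E; first by [].
by rewrite lastE; apply: eq_integral => y _; rewrite /H /= GE.
Qed.

End chain_functional.

(** * The Laplace transform along the chain *)

(** The sum of the squares of the weights carried by the last coordinate when
    the coordinates [k, k - 1, ..., 0] are integrated out in turn. *)
Fixpoint path_variance (R : realType) (kappa : R) (a : nat -> R) (k : nat)
    (b : R) : R :=
  b ^+ 2 + if k is j.+1 then path_variance kappa a j (a j + kappa * b) else 0.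

Section chain_laplace.
Context (R : realType) (X : polishMetricType R).
Local Notation dist := (@mdist R X).
Variable P : R.-pker (borel X) ~> (borel X).
Variables (kappa C : R).
Hypotheses (kappa0 : 0 <= kappa) (C0 : 0 < C).
Hypothesis P_T1 : forall x, T1 C (kernel_at P x).
Hypothesis P_contr :
  forall x y, (W1 (kiter P 1 x) (kiter P 1 y) <= (kappa * dist x y)%:E)%E.
Context d (Omega : measurableType d) (Pr : probability Omega R)
  (Xn : nat -> {RV Pr >-> borel X}) (Xn_markov : markov_chain P Xn).
Hypothesis X0_T1 : T1 C (distribution Pr (Xn 0%N)).
Local Notation path w := (fun i => Xn i w : X).

Lemma measurable_path_functional m a G (phi : R -> R) :
  (forall i, (i < m)%N -> 0 <= a i) -> coord_lipschitz m a G ->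
  measurable_fun [set: R] phi ->
  measurable_fun setT (fun w => (phi (G (path w)))%:E).
Proof.
move=> a0 GL mphi; apply/measurable_EFinP; apply: measurableT_comp => //.
by apply: (measurable_coord_lipschitz a0 GL) => i _; exact: measurable_funPT.
Qed.

Lemma measurable_path_kernel_integral k a b G (phi : R -> R) :
  (forall i, 0 <= a i) -> 0 <= b -> chain_lipschitz k.+1 a b G ->
  measurable_fun [set: R] phi -> (forall x, 0 <= phi (G x)) ->
  measurable_fun setT
    (fun w => \int[kernel_at P (Xn k w)]_y
       (phi (G (upd (path w) k.+1 y)))%:E)%E.
Proof.
move=> a0 b0 GL mphi phi0.
have mX : measurable_fun setT (Xn k) by exact: measurable_funPT.
pose H (z : (Omega * borel X)%type) := (phi (G (upd (path z.1) k.+1 z.2)))%:E.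
apply: (measurable_fun_integral_sfinite_kernel H (kernel_pullback P mX)).
  by move=> z; rewrite lee_fin.
apply/measurable_EFinP; apply: measurableT_comp => //.
pose Y i (z : (Omega * borel X)%type) : borel X := upd (path z.1) k.+1 z.2 i.
apply: (@measurable_coord_lipschitz _ _ _ _ k.+2 (upd a k.+1 b) G Y) => //.
  by move=> i _; rewrite /upd; case: ifP.
move=> i _; rewrite /Y /upd; case: (i == k.+1).
  exact: (@measurable_snd _ _ Omega (borel X)).
have mXi : measurable_fun setT (Xn i) by exact: measurable_funPT.
exact: (measurableT_comp mXi measurable_fst).
Qed.

(** The finiteness of the mean is part of the induction: it reduces to that of
    a Lipschitz function of [X_0], whose law has a first moment. Nonnegativity
    of [G] lets all exchanges of integrals be done without integrability. *)
Lemma chain_laplace k a b G :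
  (forall i, 0 <= a i) -> 0 <= b -> chain_lipschitz k a b G ->
  (forall x, 0 <= G x) ->
  exists m, (\int[Pr]_w (G (path w))%:E = m%:E /\
    \int[Pr]_w (expR (G (path w)))%:E <=
      (expR (m + C / 2 * path_variance kappa a k b))%:E)%E.
Proof.
move=> a0; elim: k b G => [|k IH] b G b0 GL G0.
- pose f y := G (upd (fun=> point) 0%N y).
  have fL : lipschitz_with b f by exact: lipschitz_upd GL.
  have GE w : G (path w) = f (Xn 0%N w).
    by apply: (eq_coord_lipschitz GL) => -[|//] _; rewrite updE.
  have mf := measurable_lipschitz b0 fL.
  have mX : measurable_fun setT (Xn 0%N) by exact: measurable_funPT.
  exists (Rintegral (distribution Pr (Xn 0%N)) setT f).
  under eq_integral do rewrite GE.
  under [X in (_ /\ (X <= _)%E)]eq_integral do rewrite GE.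
  split.
    rewrite fineK; last first.
      apply: integrable_fin_num => //.
      exact: (lipschitz_integrable X0_T1.1 b0 fL).
    rewrite ge0_integral_pushforward//; first exact/measurable_EFinP.
    by move=> y _; rewrite lee_fin; exact: G0.
  have := T1_laplace C0 X0_T1 b0 fL (fun x => G0 _).
  rewrite ge0_integral_pushforward//.
  - by rewrite /= addr0 mulrAC.
  - by apply/measurable_EFinP; exact: measurableT_comp.
- have P_P1 x := (P_T1 x).1.
  have GL' := chain_lipschitz_kernel_avg P_P1 P_contr b0 GL.
  have b'0 : 0 <= a k + kappa * b by rewrite addr_ge0 ?mulr_ge0.
  have G'0 := kernel_avg_ge0 P k G0.
  have [m [Em Ee]] := IH _ _ b'0 GL' G'0.
  have fL w : lipschitz_with b (fun y => G (upd (path w) k.+1 y)).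
    exact: lipschitz_upd GL.
  exists m; split.
    rewrite (integral_markov_step Xn_markov (fun i _ => a0 i) b0 GL
      (@measurable_id _ _ _) G0).
    rewrite -Em; apply: eq_integral => w _.
    rewrite /kernel_avg fineK//.
    apply: integrable_fin_num => //.
    exact: (lipschitz_integrable (P_P1 _) b0 (fL w)).
  have mexp : measurable_fun [set: R] expR by [].
  have e0 x : 0 <= expR (G x) by exact: expR_ge0.
  rewrite (integral_markov_step Xn_markov (fun i _ => a0 i) b0 GL mexp e0).
  apply: (@le_trans _ _ (\int[Pr]_w ((expR (C * b ^+ 2 / 2))%:E *
      (expR (kernel_avg P k G (path w)))%:E)))%E.
    apply: ge0_le_integral => //.
    + by move=> w _; apply: integral_ge0 => y _; rewrite lee_fin.
    + exact: measurable_path_kernel_integral GL mexp e0.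
    + apply: measurable_funeM; apply: (measurable_path_functional _ GL') => //.
      by move=> i _; rewrite /upd; case: ifP.
    + move=> w _; rewrite -EFinM -expRD [C * _ / _ + _]addrC.
      exact: (T1_laplace C0 (P_T1 _) b0 (fL w) (fun y => G0 _)).
  rewrite ge0_integralZl_EFin//.
  - apply: le_trans (lee_wpmul2l _ Ee) _; rewrite ?lee_fin ?expR_ge0//.
    by rewrite -expRD ler_expR /=; lra.
  - apply: (measurable_path_functional _ GL') => //.
    by move=> i _; rewrite /upd; case: ifP.
Qed.

End chain_laplace.

(** * The distance to the empirical measure as a functional of the path *)

Section empirical_distance.
Context (R : realType) (X : polishMetricType R).
Local Notation dist := (@mdist R X).
Variable n : nat.
Hypothesis n0 : (0 < n)%N.

Definition empirical_mean (f : X -> R) (x : nat -> X) : R :=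
  n%:R^-1 * \sum_(i < n) f (x i.+1).

Lemma ge0_integral_empirical (f : X -> R) (x : nat -> X) :
  measurable_fun [set: borel X] f -> (forall y, 0 <= f y) ->
  (\int[empirical_measure R (x : nat -> borel X) n]_y (f y)%:E =
   (empirical_mean f x)%:E)%E.
Proof.
move=> mf f0; have mEf : measurable_fun [set: borel X] (EFin \o f).
  exact/measurable_EFinP.
rewrite ge0_integral_mscale//; last by move=> y _; rewrite lee_fin.
rewrite ge0_integral_measure_sum//; last by move=> y _; rewrite lee_fin.
rewrite EFinM -sumEFin; congr (_ * _)%E; apply: eq_bigr => i _.
by rewrite integral_dirac// diracT mul1e.
Qed.

Lemma integral_empirical (f : X -> R) (x : nat -> X) :
  measurable_fun [set: borel X] f ->
  (\int[empirical_measure R (x : nat -> borel X) n]_y (f y)%:E =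
   (empirical_mean f x)%:E)%E.
Proof.
move=> mf; rewrite integralE.
have -> : (fun y => (f y)%:E)^\+%E = (fun y => (Num.max (f y) 0)%:E).
  by apply/funext => y; rewrite funeposE EFin_max.
have -> : (fun y => (f y)%:E)^\-%E = (fun y => (Num.max (- f y) 0)%:E).
  by apply/funext => y; rewrite funenegE EFin_max EFinN.
rewrite !ge0_integral_empirical//; last 4 first.
- by apply: measurable_maxr => //; exact: measurableT_comp.
- by move=> y; rewrite le_max lexx orbT.
- by apply: measurable_maxr.
- by move=> y; rewrite le_max lexx orbT.
rewrite -EFinB /empirical_mean -mulrBr -sumrB; congr (_ * _)%:E.
apply: eq_bigr => i _; case: (leP (f (x i.+1)) 0) => h.
  by rewrite max_l ?sub0r ?opprK// oppr_ge0.
by rewrite max_r ?subr0// oppr_le0 ltW.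
Qed.

Variables (mu : probability (borel X) R) (S : set (X -> R)).
Hypotheses (mu_P1 : in_P1 mu) (S_Lip1 : S `<=` @Lip1 R X).

Local Notation emp x := (empirical_measure R (x : nat -> borel X) n).
Let delta (x y : nat -> X) := n%:R^-1 * \sum_(i < n) dist (x i.+1) (y i.+1).

Let S_lipschitz f : S f -> lipschitz_with 1 f.
Proof. by move=> /S_Lip1 fL x y; rewrite mul1r; exact: fL. Qed.

Let S_measurable f : S f -> measurable_fun [set: borel X] f.
Proof. by move=> /S_lipschitz; exact: measurable_lipschitz. Qed.

Let S_integrable f : S f -> mu.-integrable setT (EFin \o f).
Proof. by move=> /S_lipschitz; exact: lipschitz_integrable. Qed.

Let n_ge0 : 0 <= n%:R^-1 :> R. Proof. by rewrite invr_ge0. Qed.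

Lemma dSE x : dS S mu (emp x) = maxe 0%E (ereal_sup
  [set (`|Rintegral mu setT f - empirical_mean f x|)%:E | f in S]).
Proof.
rewrite /dS; congr (maxe 0%E (ereal_sup _)); apply: eq_imagel => f Sf.
rewrite integral_empirical; last exact: S_measurable.
have -> : (\int[mu]_y (f y)%:E = (Rintegral mu setT f)%:E)%E.
  by rewrite fineK//; apply: integrable_fin_num => //; exact: S_integrable.
by rewrite -EFinB abse_EFin.
Qed.

Lemma dS_le x y : (dS S mu (emp x) <= dS S mu (emp y) + (delta x y)%:E)%E.
Proof.
have d0 : 0 <= delta x y.
  by rewrite mulr_ge0// sumr_ge0// => i _; exact: mdist_ge0.
have dS0 z : (0 <= dS S mu (emp z))%E by rewrite le_max lexx.
rewrite [leLHS]dSE ge_max adde_ge0//=.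
apply: ge_ereal_sup => _ [f Sf <-].
apply: (@le_trans _ _
  ((`|Rintegral mu setT f - empirical_mean f y|)%:E + (delta x y)%:E)%E).
  rewrite -EFinD lee_fin.
  apply: le_trans (ler_distD (empirical_mean f y) _ _) _.
  rewrite lerD2l /empirical_mean -mulrBr -sumrB normrM ger0_norm//.
  rewrite ler_wpM2l//; apply: le_trans (ler_norm_sum _ _ _) _.
  by apply: ler_sum => i _; rewrite distrC; exact: S_Lip1.
rewrite leeD2r// dSE le_max; apply/orP; right.
by apply: ereal_sup_ubound; exists f.
Qed.

(** Up to a finite [delta], the path may be replaced by a constant one; there
    the distance is at most the first moment of [mu]. *)
Lemma dS_fin_num x : dS S mu (emp x) \is a fin_num.
Proof.
pose x0 : X := point.
have dL : lipschitz_with 1 (dist x0).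
  move=> y z; rewrite mul1r ler_norml.
  have := metric_triangle x0 y z; have := metric_triangle x0 z y.
  by rewrite (metric_sym z y) => *; apply/andP; split; lra.
have di := lipschitz_integrable mu_P1 ler01 dL.
rewrite ge0_fin_numE; last by rewrite le_max lexx.
apply: le_lt_trans (dS_le x (fun=> x0)) _.
apply: lte_add_pinfty; last exact: ltry.
apply: (@le_lt_trans _ _ (Rintegral mu setT (dist x0))%:E); last exact: ltry.
rewrite dSE ge_max lee_fin Rintegral_ge0/=; last first.
  by move=> y _; exact: mdist_ge0.
apply: ge_ereal_sup => _ [f Sf <-]; rewrite lee_fin.
have -> : empirical_mean f (fun=> x0) = f x0.
  rewrite /empirical_mean sumr_const card_ord -(mulr_natl (f x0) n) mulrA.
  rewrite mulVf ?mul1r//.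
  by rewrite pnatr_eq0 -lt0n.
rewrite -[X in _ - X](Rintegral_probability_cst mu) -RintegralB//; last 2 first.
- exact: S_integrable.
- exact: finite_measure_integrable_cst.
have ii : mu.-integrable setT (EFin \o (fun y => f y - f x0)).
  have ci : mu.-integrable setT (EFin \o cst (f x0)).
    exact: finite_measure_integrable_cst.
  exact: (integrableB measurableT (S_integrable Sf) ci).
apply: le_trans (le_normr_Rintegral _ _) _ => //.
apply: le_Rintegral => //; first exact: integrable_norm.
by move=> y _; rewrite /= distrC; exact: S_Lip1.
Qed.

(** The empirical measure ignores [X_0], whence the zero weight. The factor
    [lambda] is the parameter of the Laplace transform. *)
Lemma chain_lipschitz_dS lambda : 0 <= lambda ->
  chain_lipschitz n (upd (fun=> lambda / n%:R) 0%N 0) (lambda / n%:R)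
    (fun x => lambda * fine (dS S mu (emp x))).
Proof.
move=> l0 x y; rewrite big_ord_recl /= {1}/upd ltn_eqF// updE mul0r add0r.
have -> : \sum_(i < n) upd (upd (fun=> lambda / n%:R) 0%N 0) n (lambda / n%:R)
    (bump 0 i) * dist (x (bump 0 i)) (y (bump 0 i)) = lambda * delta x y.
  rewrite /delta mulrA mulr_sumr; apply: eq_bigr => i _.
  by rewrite /upd /bump /= add1n; case: ifP.
rewrite -mulrBr normrM ger0_norm// ler_wpM2l//.
have le u v : fine (dS S mu (emp u)) <= fine (dS S mu (emp v)) + delta u v.
  by rewrite -lee_fin EFinD !fineK ?dS_fin_num//; exact: dS_le.
have dC : delta y x = delta x y.
  by rewrite /delta; under eq_bigr do rewrite metric_sym.
have dist_le (p q r : R) : p <= q + r -> q <= p + r -> `|p - q| <= r.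
  by rewrite ler_norml => *; apply/andP; split; lra.
by apply: dist_le; [exact: le|rewrite -dC; exact: le].
Qed.

End empirical_distance.

(** * The concentration inequality *)

Section variance_bound.
Context (R : realType).
Variables (kappa c : R).
Hypotheses (kappa0 : 0 <= kappa) (kappa1 : kappa < 1) (c0 : 0 <= c).

(** The fixed point of [b |-> c + kappa b], the recursion of the weights. *)
Let L := c / (1 - kappa).

Let LE : c + kappa * L = L.
Proof. by rewrite /L; field; rewrite subr_eq0 gt_eqF. Qed.

Let L0 : 0 <= L. Proof. by rewrite divr_ge0// subr_ge0 ltW. Qed.

(** Weights that start below [L] stay below it. The last step has [a_0 = 0], so
    that it only contributes [(kappa L)^2]. *)
Lemma path_variance_le k b : 0 <= b <= L ->
  path_variance kappa (upd (fun=> c) 0%N 0) k.+1 b <=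
  b ^+ 2 + k%:R * L ^+ 2 + kappa ^+ 2 * L ^+ 2.
Proof.
elim: k b => [|k IH] b /andP[b0 bL].
  rewrite /= updE add0r addr0 mul0r addr0 lerD2l exprMn.
  by rewrite ler_wpM2l ?sqr_ge0// lerXn2r// nnegrE.
have kb : kappa * b <= kappa * L by rewrite ler_wpM2l.
have b'L : c + kappa * b <= L by rewrite -LE lerD2l.
have b'0 : 0 <= c + kappa * b by rewrite addr_ge0// mulr_ge0.
have {IH} := IH (c + kappa * b); rewrite b'0 b'L => /(_ isT) IH.
rewrite [leLHS]/= -!addrA lerD2l.
have -> : upd (fun=> c) 0%N 0 k.+1 = c by [].
apply: le_trans IH _; rewrite -natr1 mulrDl mul1r lerD2r [leRHS]addrC lerD2r.
by rewrite lerXn2r// nnegrE.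
Qed.

(** The weights of times [n] and [0] are [c = (1 - kappa) L] and at most
    [kappa L], and [(1 - kappa)^2 + kappa^2 <= 1]. *)
Lemma path_variance_uniform_le n : (0 < n)%N ->
  path_variance kappa (upd (fun=> c) 0%N 0) n c <= n%:R * L ^+ 2.
Proof.
case: n => // k _.
have cL : c = (1 - kappa) * L by rewrite mulrBl mul1r -[X in X - _]LE addrK.
have /path_variance_le : 0 <= c <= L by rewrite c0 -LE lerDl mulr_ge0.
move=> /(_ k); set V := path_variance _ _ _ _ => h; apply: le_trans h _.
rewrite cL exprMn -natr1; set q := L ^+ 2.
have : 0 <= kappa * (1 - kappa) * q.
  by rewrite mulr_ge0 ?sqr_ge0// mulr_ge0// subr_ge0 ltW.
rewrite !expr2; lra.
Qed.

End variance_bound.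

Lemma chernoff_le d (Omega : measurableType d) (R : realType)
    (Pr : probability Omega R) (Y : Omega -> R) (s B : R) :
  measurable_fun setT Y ->
  (\int[Pr]_w (expR (Y w))%:E <= (expR B)%:E)%E ->
  (Pr [set w | (s <= Y w)%R] <= (expR (B - s))%:E)%E.
Proof.
move=> mY YB.
have mA : measurable [set w | s <= Y w].
  have := mY measurableT `[s, +oo[%classic (measurable_itv _).
  rewrite setTI; congr measurable.
  by apply/seteqP; split => w /=; rewrite in_itv /= andbT.
have mE : measurable_fun setT (fun w => (expR (Y w))%:E).
  by apply/measurable_EFinP; exact: measurableT_comp.
set A := [set w | _] in mA *.
have -> : (Pr A = \int[Pr]_w (\1_A w)%:E)%E by rewrite integral_indic// setIT.
apply: (@le_trans _ _ (\int[Pr]_w ((expR (- s))%:E * (expR (Y w))%:E)))%E.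
  apply: ge0_le_integral => //.
  - by apply/measurable_EFinP; exact: measurable_indic.
  - exact: measurable_funeM.
  - move=> w _; rewrite -EFinM -expRD lee_fin indicE.
    have [/set_mem /= sY|_] := boolP (w \in _); last exact: expR_ge0.
    by rewrite -[leLHS]expR0 ler_expR addrC subr_ge0.
rewrite ge0_integralZl_EFin// ?expR_ge0//.
apply: le_trans (lee_wpmul2l _ YB) _; first by rewrite lee_fin expR_ge0.
by rewrite -EFinM -expRD addrC.
Qed.

Theorem theorem1p6 (R : realType) (X : polishMetricType R)
  (kappa : R) (kappa_gt0 : 0 < kappa) (kappa_lt1 : kappa < 1)
  (P : R.-pker (borel X) ~> (borel X))
  (P_P1 : forall (n : nat) (x : X), (0 < n)%N -> in_P1 (kiter P n x))
  (P_contr : forall (n : nat) (x y : X), (0 < n)%N ->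
    (W1 (kiter P n x) (kiter P n y) <= (kappa ^+ n * mdist x y)%:E)%E)
  (d : measure_display) (Omega : measurableType d) (Pr : probability Omega R)
  (Xn : nat -> {RV Pr >-> borel X}) (Xn_markov : markov_chain P Xn)
  (mu : probability (borel X) R)
  (mu_P1 : in_P1 mu) (mu_inv : invariant_measure P mu)
  (C : R) (C_gt0 : 0 < C)
  (T1_init : T1 C (distribution Pr (Xn 0%N)))
  (T1_P : forall x : X, T1 C (kernel_at P x))
  (S : set (X -> R)) (S_Lip1 : S `<=` @Lip1 R X)
  (t : R) (t_ge0 : 0 <= t) (n : nat) (n_gt0 : (0 < n)%N) :
  let D (w : Omega) : \bar R :=
    dS S mu (empirical_measure R (fun i => Xn i w) n) in
  (Pr [set w | \int[Pr]_w' D w' + t%:E <= D w] <=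
   (expR (- ((2 * C)^-1 * n%:R * t ^+ 2 * (1 - kappa) ^+ 2)))%:E)%E.
Proof.
(* Restating the goal puts the inequality, instead of the [let], at its head. *)
pose D w := dS S mu (empirical_measure R (fun i => Xn i w) n).
suff : (Pr [set w | \int[Pr]_w' D w' + t%:E <= D w] <=
   (expR (- ((2 * C)^-1 * n%:R * t ^+ 2 * (1 - kappa) ^+ 2)))%:E)%E by [].
pose F (x : nat -> X) :=
  fine (dS S mu (empirical_measure R (x : nat -> borel X) n)).
have DE w : D w = (F (fun i => Xn i w))%:E by rewrite fineK// dS_fin_num.
have F0 x : 0 <= F x by rewrite fine_ge0// le_max lexx.
have mF : measurable_fun setT (fun w => F (fun i => Xn i w)).
  have FL : coord_lipschitz n.+1
      (upd (upd (fun=> 1 / n%:R) 0%N 0) n (1 / n%:R)) F.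
    move=> x y; have := chain_lipschitz_dS n_gt0 mu_P1 S_Lip1 ler01 x y.
    by rewrite !mul1r.
  apply: (@measurable_coord_lipschitz _ _ _ Omega n.+1 _ F
    (fun i w => Xn i w) _ FL).
    by move=> i _; rewrite /upd; do 2 case: ifP => //.
  by move=> i _; exact: measurable_funPT.
have mD : measurable_fun setT D.
  apply: (eq_measurable_fun (fun w => (F (fun i => Xn i w))%:E)) => //.
  exact/measurable_EFinP.
have contr1 x y : (W1 (kiter P 1 x) (kiter P 1 y) <= (kappa * mdist x y)%:E)%E.
  by have := P_contr 1%N x y erefl; rewrite expr1.
have nR : 0 < n%:R :> R by rewrite ltr0n.
have k1 : 0 < 1 - kappa by rewrite subr_gt0.
(* For [t = 0] the parameter [lambda] below would vanish. *)
move: t_ge0; rewrite le_eqVlt => /predU1P[<-|t0].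
  rewrite expr0n /= mulr0 mul0r oppr0 expR0.
  apply: probability_le1; rewrite -[X in measurable X]setTI.
  exact: emeasurable_fun_c_infty.
(* The minimiser of [C lambda^2 / (2 n (1 - kappa)^2) - lambda t]. *)
pose lambda := t * n%:R * (1 - kappa) ^+ 2 / C.
have l0 : 0 < lambda by rewrite divr_gt0// !mulr_gt0// exprn_gt0.
pose a : nat -> R := upd (fun=> lambda / n%:R) 0%N 0.
have c0 : 0 <= lambda / n%:R by rewrite divr_ge0 ?ltW.
have a0 i : 0 <= a i by rewrite /a /upd; case: ifP.
have GL := chain_lipschitz_dS n_gt0 mu_P1 S_Lip1 (ltW l0).
have G0 x : 0 <= lambda * F x by rewrite mulr_ge0// ltW.
have [m [Em Ee]] := chain_laplace (ltW kappa_gt0) C_gt0 T1_P contr1 Xn_markov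
    T1_init a0 c0 GL G0.
have EF : (\int[Pr]_w D w = (m / lambda)%:E)%E.
  under eq_integral do rewrite DE.
  have : (\int[Pr]_w (lambda%:E * (F (fun i => Xn i w))%:E) = m%:E)%E.
    by rewrite -Em; apply: eq_integral => w _; rewrite EFinM.
  rewrite ge0_integralZl_EFin ?ltW//; last 2 first.
  - by move=> w _; rewrite lee_fin.
  - exact/measurable_EFinP.
  case: (integral _ _ _) => [r| |]; last 2 first.
  - by rewrite gt0_muley ?lte_fin.
  - by rewrite gt0_muleNy ?lte_fin.
  by move=> [<-]; rewrite mulrAC divff ?mul1r// gt_eqF.
have mlF : measurable_fun setT (fun w => lambda * F (fun i => Xn i w)).
  exact: measurable_funM.
rewrite EF (_ : [set w | _] =
    [set w | m + lambda * t <= lambda * F (fun i => Xn i w)]); last first.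
  apply: eq_set => w; rewrite DE -EFinD lee_fin -(ler_pM2l l0) mulrDr.
  by rewrite [lambda * (m / _)]mulrC divfK// gt_eqF.
apply: le_trans (chernoff_le _ mlF Ee) _.
rewrite lee_fin ler_expR.
have V := path_variance_uniform_le (ltW kappa_gt0) kappa_lt1 c0 n_gt0.
have exponent :
    C / 2 * (n%:R * (lambda / n%:R / (1 - kappa)) ^+ 2) - lambda * t =
    - ((2 * C)^-1 * n%:R * t ^+ 2 * (1 - kappa) ^+ 2).
  by rewrite /lambda; field; rewrite !gt_eqF.
have C2 : 0 <= C / 2 by rewrite divr_ge0// ltW.
by have := ler_wpM2l C2 V; rewrite -exponent -/a; lra.
Qed.
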